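(* Let $(G,\mathcal{O},W)$ be a connected graph with geometry, let $X_n$ be the random walk on $V$ with transition probabilities $p(x,y)=W_E(x,y)/w_V(x)$, and let $D$ be an $\alpha$-weight regular domain of $G$ with nonempty boundary. For $k$ a positive integer let $$A_{1,k}=\sum_{x\in iD}E^x[\tau^k]\,W_V(x),\qquad A_{2,k}=k!\sup_{f\in C^0(iD)\setminus\{0\}}\frac{\langle f,1\rangle_{iD}^2}{|\langle f,\Delta_{iD}^kf\rangle_{iD}|}.$$ Then for every positive integer $k$, $$A_{1,k}=A_{2,k}+\sum_{j=1}^{k-1}(-\alpha)^{j-k}\left\{{k\atop j}\right\}A_{2,j}$$ where $\left\{{k\atop j}\right\}$ are the Stirling numbers of the second kind, and $$A_{2,k}=A_{1,k}+\sum_{j=1}^{k-1}(-\alpha)^{j-k}\left[{k\atop j}\right]A_{1,j}$$ where $\left[{k\atop j}\right]$ are the (signed) Stirling numbers of the first kind.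
   Context: A bidirected graph $G=(V,E)$ has edge set $E\subset V\times V$ with $(x,y)\in E$ iff $(y,x)\in E$, no self edges $(x,x)$, and every vertex of finite degree ($V$ may be infinite). An orientation is a subset $\mathcal{O}\subset E$ containing exactly one of $(x,y),(y,x)$ for each edge. A weighting is a pair $W=(W_V,W_E)$ with $W_V:V\to(0,\infty)$ and $W_E:V\times V\to[0,\infty)$ positive exactly on $E$, such that $W_E(x,y)W_V(x)=W_E(y,x)W_V(y)$ for all $x,y\in V$. A graph with geometry is a triple $(G,\mathcal{O},W)$ with $G$ connected bidirected, $\mathcal{O}$ an orientation, $W$ a weighting. The auxiliary weighting is $w_V(x)=\sum_{(x,y)\in E}W_E(x,y)$. For a bidirected subgraph $D=(V',E')$ of $G$, a vertex $x\in V'$ is interior if for all $y\in V$ with $(x,y)\in E$ one has $y\in V'$ and $(x,y)\in E'$. $iD$ is the set of interior vertices, and $\partial D=V'\setminus iD$ is the boundary. A domain of $G$ is a finite connected bidirected subgraph with $iD\neq\emptyset$. $D$ is $\alpha$-weight regular if $w_V(x)=\alpha$ for all $x\in iD$. $C^0(iD)$ is the space of real functions on $iD$, with inner product $\langle f,g\rangle_{iD}=\sum_{x\in iD}f(x)g(x)W_V(x)$. The interior Laplace operator $\Delta_{iD}:C^0(iD)\to C^0(iD)$ is $\Delta_{iD}f(x)=w_V(x)f(x)-\sum_{y\in iD}W_E(x,y)f(y)$. $X_n$ is the Markov chain on $V$ with transition probabilities $p$; $P^x,E^x$ are the probability and expectation for the chain started at $x$. $\eta=\inf\{n\ge 0:X_n\notin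 iD\}$ and the exit time is $\tau=\sum_{n=0}^{\eta-1}\frac{1}{w_V(X_n)}$. Stirling numbers: $\left\{{k\atop n}\right\}=\frac{(-1)^n}{n!}\sum_{m=1}^n\binom{n}{m}(-1)^m m^k$ for positive integers $k,n$; $\left[{k\atop n}\right]$ is defined by $x(x-1)\cdots(x-k+1)=\sum_{n=1}^k\left[{k\atop n}\right]x^n$. *)

(* Defs.v *)
From HB Require Import structures.
From mathcomp Require Import all_boot all_order all_algebra.
From mathcomp Require Import all_classical all_reals all_analysis.

Set Implicit Arguments.
Unset Strict Implicit.
Unset Printing Implicit Defensive.

Import Order.TTheory GRing.Theory Num.Theory.

Local Open Scope classical_set_scope.
Local Open Scope ring_scope.

Record bigraph (V : choiceType) := Bigraph {
  edge : rel V;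
  edge_sym : symmetric edge;
  edge_irr : irreflexive edge;
  edge_finite : forall x, finite_set [set y | edge x y] }.

Definition edge_connected (V : choiceType) (A : set V) (e : rel V) :=
  forall x y, A x -> A y -> exists2 p : seq V, path e x p & last x p = y.

Record orientation (V : choiceType) (G : bigraph V) := Orientation {
  oriented : rel V;
  oriented_edge : forall x y, oriented x y -> edge G x y;
  oriented_one : forall x y, edge G x y -> oriented x y (+) oriented y x }.

Record weighting (R : realType) (V : choiceType) (G : bigraph V) := Weighting {
  WV : V -> R;
  WE : V -> V -> R;
  WV_gt0 : forall x, 0 < WV x;
  WE_ge0 : forall x y, 0 <= WE x y;
  WE_gt0 : forall x y, (0 < WE x y) = edge G x y;
  WE_balance : forall x y, WE x y * WV x = WE y x * WV y }.

Record geometric_graph (R : realType) (V : choiceType) := GeometricGraph {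
  graph : bigraph V;
  graph_connected : edge_connected [set: V] (edge graph);
  graph_orientation : orientation graph;
  weights : weighting R graph }.

Record subgraph (V : choiceType) (G : bigraph V) := Subgraph {
  sub_vertex : set V;
  sub_edge : rel V;
  sub_edge_edge : forall x y, sub_edge x y -> edge G x y;
  sub_edge_vertex :
    forall x y, sub_edge x y -> sub_vertex x /\ sub_vertex y;
  sub_edge_sym : symmetric sub_edge }.

Section Subgraph.
Variables (V : choiceType) (G : bigraph V) (D : subgraph G).

Definition sub_interior : set V :=
  [set x | sub_vertex D x /\
           forall y, edge G x y -> sub_vertex D y /\ sub_edge D x y].

Definition sub_boundary : set V := sub_vertex D `\` sub_interior.

Definition is_domain : Prop :=
  [/\ finite_set (sub_vertex D),
      edge_connected (sub_vertex D) (sub_edge D)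
    & sub_interior !=set0].

End Subgraph.

Section Weights.
Variables (R : realType) (V : choiceType) (G : bigraph V) (W : weighting R G).

Definition aux_weight (x : V) : R := \sum_(y \in [set y | edge G x y]) WE W x y.

Definition walk_prob (x y : V) : R := WE W x y / aux_weight x.

Definition weight_regular (alpha : R) (D : subgraph G) : Prop :=
  forall x, sub_interior D x -> aux_weight x = alpha.

Variable D : subgraph G.

(* [C0] is the space of functions on the subtype of interior vertices; the
   finitely supported sums below are true sums as soon as [D] is finite. *)
Definition C0 : Type := sub_interior D -> R.

Definition inner (f g : C0) : R :=
  \sum_(x \in [set: sub_interior D]) (f x * g x * WV W (val x)).

Definition interior_laplace (f : C0) : C0 := fun x =>
  aux_weight (val x) * f x -
  \sum_(y \in [set: sub_interior D]) (WE W (val x) (val y) * f y).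

(* When [D] is a domain with nonempty boundary of a connected graph,
   [interior_laplace] is positive definite for [inner], so that none of the
   denominators vanishes. *)
Definition dual_quotient (k : nat) (f : C0) : R :=
  inner f (cst 1) ^+ 2 / `|inner f (iter k interior_laplace f)|.

Definition A2 (k : nat) : \bar R :=
  ((k`!)%:R%:E *
   ereal_sup [set (dual_quotient k f)%:E | f in [set f : C0 | f <> cst 0%R]])%E.

End Weights.

(* A Markov chain with values in the discrete space [V], realised on one
   measurable space with one law [P x] for each starting point [x]. The Markov
   property is stated with the conditional probability multiplied out. *)
Definition is_markov_chain (R : realType) (V : choiceType) (p : V -> V -> R)
    (d : measure_display) (Omega : measurableType d)
    (P : V -> probability Omega R) (X : nat -> Omega -> V) : Prop :=
  [/\ forall n (A : set V), measurable (X n @^-1` A),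
      forall x, P x [set w | X 0%N w = x] = 1%E
    & forall x n (s : nat -> V),
        P x [set w | forall i, (i <= n.+1)%N -> X i w = s i] =
        (P x [set w | forall i, (i <= n)%N -> X i w = s i] *
         (p (s n) (s n.+1))%:E)%E].

Section ExitTime.
Variables (R : realType) (V : choiceType) (G : bigraph V) (W : weighting R G).
Variables (D : subgraph G) (Omega : Type) (X : nat -> Omega -> V).

Definition exit_index (w : Omega) : \bar R :=
  ereal_inf [set n%:R%:E | n in [set n : nat | ~ sub_interior D (X n w)]].

Definition exit_time (w : Omega) : \bar R :=
  (\sum_(0 <= n <oo | n%:R%:E < exit_index w)
     ((aux_weight W (X n w))^-1)%:E)%E.

End ExitTime.

Definition A1 (R : realType) (V : choiceType) (G : bigraph V)
    (W : weighting R G) (D : subgraph G) (d : measure_display)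
    (Omega : measurableType d) (P : V -> probability Omega R)
    (X : nat -> Omega -> V) (k : nat) : \bar R :=
  (\sum_(x \in sub_interior D)
     ((\int[P x]_w (exit_time W D X w ^+ k)) * (WV W x)%:E))%E.

Definition stirling2 (R : realType) (k n : nat) : R :=
  (-1) ^+ n / n`!%:R *
  \sum_(1 <= m < n.+1) ('C(n, m)%:R * (-1) ^+ m * m%:R ^+ k).

Definition stirling1 (R : realType) (k n : nat) : R :=
  (\prod_(0 <= i < k) ('X - (i%:R)%:P) : {poly R})`_n.

(* Main.v *)
(* Let [K] be the transition matrix of the walk killed outside [iD] and let
   [u_n = K^n 1], so that [u_n x = P^x(eta > n)]; on [iD] one has [tau = eta /
   alpha] and [Delta_iD = alpha (1 - K)].  Summation by parts gives
   [E^x[phi(eta)] = sum_n (phi (n + 1) - phi n) u_n x] when [phi 0 = 0].  For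
   the rising factorial [phi] of order [k] this is [k!] times
   [F_k = sum_n 'C(n + k - 1, k - 1) K^n 1], and Pascal's rule
   [F_(k+1) = K F_(k+1) + F_k] says that [Delta_iD^k F_k = alpha^k].
   The sums converge because [u_n] tends to [0], by the maximum principle for
   [K] (this is where the connectedness of [G] and the nonempty boundary enter).
   [Delta_iD^k] being symmetric and nonnegative, the Cauchy-Schwarz inequality
   shows that the supremum in [A2] is attained at [F_k] and that
   [A2 k = k! alpha^-k <F_k, 1>].  So [alpha^k A1 k] and [alpha^k A2 k] are the
   values of one linear functional at the [k]-th power and at the [k]-th rising
   factorial, and the Stirling numbers convert one basis into the other. *)
Require Import Defs.
From mathcomp Require Import all_boot all_order all_algebra.
From mathcomp Require Import all_classical all_reals all_analysis.
From mathcomp Require Import finmap measurable_realfun ring lra.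
Import Order.TTheory GRing.Theory Num.Theory.
Import numFieldNormedType.Exports.
Local Open Scope classical_set_scope.
Local Open Scope ring_scope.
Set Implicit Arguments.
Unset Strict Implicit.
Unset Printing Implicit Defensive.

(* [k`! * rising_coef k n] is the increment of the rising factorial of order
   [k] from [n] to [n + 1], see [risingB]. *)
Definition rising_coef (k n : nat) : nat :=
  if k is k'.+1 then 'C(n + k', k') else n == 0%N.

Lemma rising_coefS (k n : nat) :
  rising_coef k.+1 n.+1 = (rising_coef k.+1 n + rising_coef k n.+1)%N.
Proof. by case: k => [|k] /=; rewrite ?bin0// !addSn addnS binS addnC. Qed.

(** * Substochastic kernels on a finite set: survival probabilities and their rising-factorial
    sums *)

Section SubMarkov.
Variables (R : realType) (I : choiceType) (s : seq I) (K : I -> I -> R).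
Hypothesis mem_s : forall x, x \in s.
Hypothesis K_ge0 : forall x y, 0 <= K x y.
Hypothesis K_le1 : forall x, \sum_(y <- s) K x y <= 1.
Hypothesis K_max : forall f : I -> R,
  (forall x, f x <= \sum_(y <- s) K x y * f y) -> forall x, f x <= 0.

Definition kop (f : I -> R) (x : I) : R := \sum_(y <- s) K x y * f y.

Definition surv (n : nat) : I -> R := iter n kop (cst 1).

Definition rising_sum (k N : nat) (x : I) : R :=
  \sum_(0 <= n < N) (rising_coef k n)%:R * surv n x.

(** The function [F_k] of the overview. [limn] is total, so this is a genuine limit only by
    [rising_sum_cvg]. *)
Definition rising_moment (k : nat) (x : I) : R :=
  limn (fun N => rising_sum k N x).

Lemma ler_kop (f g : I -> R) (x : I) :
  (forall y, f y <= g y) -> kop f x <= kop g x.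
Proof. by move=> fg; apply: ler_sum => y _; exact: ler_wpM2l. Qed.

Lemma kopD (f g : I -> R) (x : I) :
  kop (fun y => f y + g y) x = kop f x + kop g x.
Proof. by rewrite -big_split; apply: eq_bigr => y _; rewrite mulrDr. Qed.

Lemma kopZ (a : R) (f : I -> R) (x : I) :
  kop (fun y => a * f y) x = a * kop f x.
Proof. by rewrite mulr_sumr; apply: eq_bigr => y _; rewrite mulrCA. Qed.

Lemma kop_sum (a b : nat) (F : nat -> I -> R) (x : I) :
  kop (fun y => \sum_(a <= n < b) F n y) x = \sum_(a <= n < b) kop (F n) x.
Proof.
rewrite exchange_big; apply: eq_bigr => y _; exact: mulr_sumr.
Qed.

Lemma kop_cvg (F : nat -> I -> R) (f : I -> R) (x : I) :
  (forall y, F n y @[n --> \oo] --> f y) ->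
  kop (F n) x @[n --> \oo] --> kop f x.
Proof.
move=> Ff; apply: cvg_big; first exact: add_continuous.
by move=> y _; apply: cvgMl_tmp; exact: Ff.
Qed.

Lemma surv_ge0 (n : nat) (x : I) : 0 <= surv n x.
Proof.
by elim: n x => [|n IH] x //=; apply: sumr_ge0 => y _; exact: mulr_ge0.
Qed.

Lemma surv_nonincreasing (n : nat) (x : I) : surv n.+1 x <= surv n x.
Proof.
elim: n x => [|n IH] x; last exact: ler_kop.
rewrite /surv /= /kop; under eq_bigr do rewrite mulr1.
exact: K_le1.
Qed.

Lemma surv_cvg (x : I) : cvgn (fun n => surv n x).
Proof.
apply: nonincreasing_is_cvgn; last by exists 0 => _ [n _ <-]; exact: surv_ge0.
by apply/nonincreasing_seqP => n; exact: surv_nonincreasing.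
Qed.

(* The pointwise limit of the survival probabilities is a fixed point of [K],
   hence nonpositive by the maximum principle. *)
Lemma surv_limn_le0 (x : I) : limn (fun n => surv n x) <= 0.
Proof.
apply: (K_max (f := fun x => limn (fun n => surv n x))) => {}x.
have : surv n x @[n --> \oo] --> kop (fun y => limn (fun n => surv n y)) x.
  by rewrite -cvg_shiftS; apply: kop_cvg => y; exact: surv_cvg.
by move=> /cvg_lim -> //.
Qed.

(** The sum over the finite list [s] dominates each of its terms and has a nonpositive limit, which
    makes the pointwise decay uniform. *)
Lemma surv_le_half : exists L, forall x, surv L x <= 2^-1.
Proof.
pose m n := \sum_(x <- s) surv n x.
have mcvg : m n @[n --> \oo] --> \sum_(x <- s) limn (fun n => surv n x).
  by apply: cvg_big => [|x _]; [exact: add_continuous|exact: surv_cvg].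
have m0 : \sum_(x <- s) limn (fun n => surv n x) < 2^-1.
  apply: (@le_lt_trans _ _ 0); last by rewrite invr_gt0.
  by apply: sumr_le0 => x _; exact: surv_limn_le0.
have [L _ /(_ L (leqnn L)) /= mL] : \forall n \near \oo, m n < 2^-1.
  exact: (cvgr_lt _ mcvg).
exists L => x.
apply: le_trans (ltW mL); rewrite /m (big_rem x)//= lerDl.
by apply: sumr_ge0 => y _; exact: surv_ge0.
Qed.

(* [G] is twice the Green function truncated at a time [L] after which at most
   half of the mass survives. *)
Lemma green_function : exists G : I -> R,
  (forall x, 0 <= G x) /\ (forall x, kop G x + 1 <= G x).
Proof.
have [L uL] := surv_le_half.
exists (fun x => 2 * \sum_(0 <= n < L) surv n x); split=> x.
  by rewrite mulr_ge0// sumr_ge0// => n _; exact: surv_ge0.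
rewrite kopZ kop_sum.
(* Telescoping gives [G - K G = 2 * (1 - surv L)], which is at least 1 by the choice of [L]. *)
have := telescope_sumr (fun n => surv n x) (leq0n L).
rewrite sumrB -[X in X - _ = _]/(\sum_(0 <= n < L) kop (surv n) x).
have -> : surv 0 x = 1 by [].
by have := uL x; lra.
Qed.

(** Truncated form of [F_(k+1) = K F_(k+1) + F_k]: Pascal's rule splits each coefficient, and
    [surv n.+1 = K (surv n)] absorbs the index shift, whence [N] under [kop]. *)
Lemma rising_sumS (k N : nat) (x : I) :
  rising_sum k.+1 N.+1 x =
  kop (rising_sum k.+1 N) x + rising_sum k N.+1 x.
Proof.
rewrite /rising_sum kop_sum ![\sum_(0 <= n < N.+1) _]big_nat_recl//.
rewrite addrCA -big_split; congr (_ + _).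
  by congr (_%:R * _); case: k => //= k; rewrite !add0n !binn.
by apply: eq_bigr => n _; rewrite rising_coefS natrD mulrDl kopZ.
Qed.

Lemma rising_sum0 (N : nat) (x : I) : rising_sum 0 N.+1 x = 1.
Proof.
rewrite /rising_sum big_nat_recl//= mul1r big1 ?addr0// => n _.
by rewrite mul0r.
Qed.

(** If [C] bounds order [k], then [C * G] is a supersolution of the recurrence [rising_sumS], since
    [K (C * G) + C <= C * G]; induction on [N] keeps order [k.+1] below it. *)
Lemma rising_sum_bounded (k : nat) :
  exists C, forall N x, rising_sum k N x <= C.
Proof.
elim: k => [|k [C IH]].
  exists 1 => -[|N] x; last by rewrite rising_sum0.
  by rewrite /rising_sum big_geq.
have [G [G0 GK]] := green_function.
(* The empty sum at [N = 0] forces the bound to be nonnegative. *)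
have C0 (x : I) : 0 <= C by have := IH 0%N x; rewrite /rising_sum big_geq.
have bound N x : rising_sum k.+1 N x <= C * G x.
  elim: N x => [|N IHN] x.
    by rewrite /rising_sum big_geq// mulr_ge0// (C0 x).
  rewrite rising_sumS; apply: (@le_trans _ _ (C * kop G x + C)).
    by rewrite -kopZ lerD//; exact: ler_kop.
  by rewrite -{2}[C]mulr1 -mulrDr ler_wpM2l// (C0 x).
exists (\sum_(x <- s) C * G x) => N x; apply: (le_trans (bound N x)).
rewrite (big_rem x)//= lerDl; apply: sumr_ge0 => y _.
by rewrite mulr_ge0// (C0 x).
Qed.

Lemma rising_sum_cvg (k : nat) (x : I) :
  rising_sum k N x @[N --> \oo] --> rising_moment k x.
Proof.
apply: nondecreasing_is_cvgn.
  apply/nondecreasing_seqP => N; rewrite /rising_sum big_nat_recr//= lerDl.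
  by rewrite mulr_ge0// surv_ge0.
have [C leC] := rising_sum_bounded k.
by exists C => _ [N _ <-].
Qed.

Lemma rising_moment0 (x : I) : rising_moment 0 x = 1.
Proof.
apply/cvg_lim => //; rewrite -cvg_shiftS.
by under eq_fun do rewrite rising_sum0; exact: cvg_cst.
Qed.

Lemma rising_momentS (k : nat) (x : I) :
  rising_moment k.+1 x = kop (rising_moment k.+1) x + rising_moment k x.
Proof.
apply/cvg_lim => //; rewrite -cvg_shiftS.
under eq_fun do rewrite rising_sumS.
apply: cvgD; first by apply: kop_cvg => y; exact: rising_sum_cvg.
by rewrite (cvg_shiftS (fun N => rising_sum k N x)); exact: rising_sum_cvg.
Qed.

End SubMarkov.

(** * The Laplacian of a reversible kernel: positivity, Cauchy-Schwarz and the dual variational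
    problem *)

Section Energy.
Variables (R : realType) (I : choiceType) (s : seq I) (K : I -> I -> R).
Hypothesis mem_s : forall x, x \in s.
Hypothesis K_ge0 : forall x y, 0 <= K x y.
Hypothesis K_le1 : forall x, \sum_(y <- s) K x y <= 1.
Variables (m : I -> R) (a : R).
Hypothesis m_ge0 : forall x, 0 <= m x.
Hypothesis K_balance : forall x y, K x y * m x = K y x * m y.
Hypothesis a_gt0 : 0 < a.

Local Notation T := (kop s K).
Local Notation F := (rising_moment s K).

Definition ip (f g : I -> R) : R := \sum_(x <- s) f x * g x * m x.

Definition lap (f : I -> R) (x : I) : R := a * (f x - T f x).

Lemma ip_linr (f g h : I -> R) (b c : R) :
  ip f (fun x => b * g x + c * h x) = b * ip f g + c * ip f h.
Proof.
rewrite /ip !mulr_sumr -big_split; apply: eq_bigr => x _ /=; ring.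
Qed.

Lemma ipC (f g : I -> R) : ip f g = ip g f.
Proof. by apply: eq_bigr => x _; rewrite [f x * g x]mulrC. Qed.

Lemma ip_linl (f g h : I -> R) (b c : R) :
  ip (fun x => b * g x + c * h x) f = b * ip g f + c * ip h f.
Proof. by rewrite ipC ip_linr ![ip f _]ipC. Qed.

Lemma ip_kop (f g : I -> R) : ip f (T g) = ip (T f) g.
Proof.
rewrite /ip; under eq_bigr do rewrite mulr_sumr mulr_suml.
rewrite exchange_big; apply: eq_bigr => x _ /=.
rewrite /kop !mulr_suml; apply: eq_bigr => y _.
by rewrite mulrCA mulrAC K_balance; ring.
Qed.

Lemma lapE (f : I -> R) : lap f = (fun x => a * f x + (- a) * T f x).
Proof. by apply/funext => x; rewrite /lap mulrBr mulNr. Qed.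

Lemma ip_lap (f g : I -> R) : ip f (lap g) = ip (lap f) g.
Proof. by rewrite !lapE ip_linr ip_linl ip_kop. Qed.

Lemma ip_ge0 (f : I -> R) : 0 <= ip f f.
Proof. by apply: sumr_ge0 => x _; rewrite mulr_ge0// -expr2 sqr_ge0. Qed.

(** Sum [2 f(x) f(y) <= f(x)^2 + f(y)^2] against the weight [K x y * m x], symmetric by [K_balance];
    both of its marginals are at most [m]. *)
Lemma ip_kop_le (f : I -> R) : ip f (T f) <= ip f f.
Proof.
have E : \sum_(x <- s) \sum_(y <- s) f y ^+ 2 * (K x y * m x) <= ip f f.
  rewrite exchange_big; apply: ler_sum => x _ /=.
  rewrite -mulr_sumr -expr2; apply: ler_wpM2l; first exact: sqr_ge0.
  under eq_bigr do rewrite K_balance.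
  by rewrite -mulr_suml ler_piMl.
have E' : \sum_(x <- s) \sum_(y <- s) f x ^+ 2 * (K x y * m x) <= ip f f.
  apply: ler_sum => x _.
  rewrite -mulr_sumr -expr2; apply: ler_wpM2l; first exact: sqr_ge0.
  by rewrite -mulr_suml ler_piMl.
have : 2 * ip f (T f) <= \sum_(x <- s) \sum_(y <- s) f y ^+ 2 * (K x y * m x)
    + \sum_(x <- s) \sum_(y <- s) f x ^+ 2 * (K x y * m x).
  rewrite -big_split mulr_sumr; apply: ler_sum => x _ /=.
  rewrite -big_split mulr_sumr mulr_suml mulr_sumr; apply: ler_sum => y _ /=.
  rewrite -subr_ge0 (_ : _ - _ = (f x - f y) ^+ 2 * (K x y * m x)); last first.
    by ring.
  by rewrite mulr_ge0 ?sqr_ge0// mulr_ge0.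
lra.
Qed.

Lemma ip_lap_ge0 (f : I -> R) : 0 <= ip f (lap f).
Proof.
by rewrite lapE ip_linr mulNr -mulrBr mulr_ge0 ?subr_ge0 ?ip_kop_le// ltW.
Qed.

Lemma ip_iter_lap (k : nat) (f g : I -> R) :
  ip f (iter k lap g) = ip (iter k lap f) g.
Proof. by elim: k f => [//|k IH] f; rewrite iterS ip_lap IH -iterSr. Qed.

(** By symmetry half of the iterates move to the left factor, leaving the square of a norm for even
    [k] and one Laplacian for odd [k]. *)
Lemma ip_iter_lap_ge0 (k : nat) (f : I -> R) : 0 <= ip f (iter k lap f).
Proof.
rewrite -(odd_double_half k) -addnn addnCA !iterD ip_iter_lap.
by case: (odd k); [exact: ip_lap_ge0|exact: ip_ge0].
Qed.

Lemma iter_lap_lin (k : nat) (f g : I -> R) (b c : R) :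
  iter k lap (fun x => b * f x + c * g x) =
  (fun x => b * iter k lap f x + c * iter k lap g x).
Proof.
elim: k => [//|k IH]; rewrite !iterS IH; apply/funext => x.
by rewrite /lap kopD !kopZ; ring.
Qed.

(** The form is only known to be nonnegative, so besides the usual argument on [t * f + u * g] the
    degenerate case [C = 0] needs its own treatment. *)
Lemma iter_lap_cauchy_schwarz (k : nat) (f g : I -> R) :
  ip f (iter k lap g) ^+ 2 <= ip f (iter k lap f) * ip g (iter k lap g).
Proof.
set B := ip f _; set A := ip f _; set C := ip g _.
have H t u : 0 <= t ^+ 2 * A + 2 * t * u * B + u ^+ 2 * C.
  have := ip_iter_lap_ge0 k (fun x => t * f x + u * g x).
  rewrite iter_lap_lin ip_linl !ip_linr -/A -/B -/C.
  have -> : ip g (iter k lap f) = B by rewrite ip_iter_lap ipC.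
  by lra.
have := H 0 1; rewrite expr0n /= !(mul0r, mulr0, add0r, expr1n, mul1r) => C0.
have [C1|C1] := ltP 0 C.
  rewrite -subr_ge0 -(pmulr_rge0 _ C1).
  (* At [(t, u) = (C, - B)] the quadratic form equals [C * (A * C - B ^+ 2)]. *)
  by have := H C (- B); lra.
have {C0 C1} C1 : C = 0 by apply/eqP; rewrite eq_le C0 C1.
rewrite C1 mulr0; case: (eqVneq B 0) => [->|B0]; first by rewrite expr0n.
(* With [C = 0] and [B != 0] the form is affine in [u]; this [u] gives it the value [-1]. *)
have := H 1 (- (A + 1) / (2 * B)); rewrite C1.
suff -> : 1 ^+ 2 * A + 2 * 1 * (- (A + 1) / (2 * B)) * B +
    (- (A + 1) / (2 * B)) ^+ 2 * 0 = - 1 by rewrite oppr_ge0 ler10.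
by field.
Qed.

Hypothesis K_max : forall f : I -> R,
  (forall x, f x <= \sum_(y <- s) K x y * f y) -> forall x, f x <= 0.

Lemma lap_rising_moment (k : nat) : lap (F k.+1) = (fun x => a * F k x).
Proof.
apply/funext => x; rewrite /lap [in X in X - _]rising_momentS//.
by rewrite addrAC subrr add0r.
Qed.

Lemma iter_lap_rising_moment (k : nat) : iter k lap (F k) = cst (a ^+ k).
Proof.
elim: k => [|k IH].
  by apply/funext => x; rewrite /= rising_moment0.
rewrite iterSr lap_rising_moment.
have := iter_lap_lin k (F k) (F k) a 0.
under [X in iter k lap X = _ -> _]eq_fun do rewrite mul0r addr0.
by move=> ->; rewrite IH; apply/funext => x; rewrite mul0r addr0 exprS.
Qed.

(** Pairing [f] with [lap^k (F k) = a^k] gives [a^k <f, 1>], so Cauchy-Schwarz against [F k] bounds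
    every quotient. The point [x0] ensures that [F k] is an admissible nonzero function. *)
Lemma sup_dual_quotient (k : nat) (x0 : I) :
  ereal_sup [set (ip f (cst 1) ^+ 2 / `|ip f (iter k lap f)|)%:E
    | f in [set f : I -> R | f <> cst 0]] = (a ^- k * ip (F k) (cst 1))%:E.
Proof.
have ak0 : a ^+ k != 0 by rewrite expf_neq0 ?gt_eqF.
have Lk f : ip f (iter k lap (F k)) = a ^+ k * ip f (cst 1).
  rewrite iter_lap_rising_moment /ip mulr_sumr.
  by apply: eq_bigr => x _ /=; ring.
apply/eqP; rewrite eq_le; apply/andP; split.
  apply: ge_ereal_sup => _ [f _ <-]; rewrite lee_fin.
  rewrite ger0_norm ?ip_iter_lap_ge0//.
  have := iter_lap_cauchy_schwarz k f (F k); rewrite !Lk.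
  have := ip_iter_lap_ge0 k f; rewrite le_eqVlt => /predU1P[<-|f0 CS].
    (* For zero energy the quotient is 0 by the convention for division, and nonnegativity of
       [<F k, 1>] suffices. *)
    rewrite invr0 mulr0 => _.
    have := ip_iter_lap_ge0 k (F k); rewrite Lk pmulr_rge0 ?exprn_gt0// => F0.
    by rewrite mulr_ge0// invr_ge0 exprn_ge0// ltW.
  rewrite ler_pdivrMr// -(ler_pM2l (exprn_gt0 2 (exprn_gt0 k a_gt0))).
  rewrite -exprMn; apply: (le_trans CS); rewrite le_eqVlt; apply/orP; left.
  by apply/eqP; field.
apply: ereal_sup_ubound; exists (F k) => /=.
  (* A vanishing [F k] would have zero image under [lap^k], whereas that image is the nonzero
     constant [a ^+ k]. *)
  move=> F0; have := iter_lap_rising_moment k; rewrite F0.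
  have := iter_lap_lin k (cst 0) (cst 0) 0 0.
  under [X in iter k lap X = _ -> _]eq_fun do rewrite !mul0r addr0.
  move=> -> /(congr1 (fun f => f x0)) /=; rewrite !mul0r addr0 => /esym/eqP.
  by rewrite (negbTE ak0).
rewrite ger0_norm ?ip_iter_lap_ge0// Lk; congr (_%:E).
have [->|F0] := eqVneq (ip (F k) (cst 1)) 0.
  by rewrite expr0n !(mulr0, mul0r).
by field; rewrite F0 ak0.
Qed.

End Energy.

(** * Stirling numbers as change of basis between powers and rising factorials *)

Section Stirling.
Variable R : realType.
Implicit Types (x : R) (k n j : nat).

Definition falling k x : R := \prod_(0 <= i < k) (x - i%:R).

Definition rising k x : R := \prod_(0 <= i < k) (x + i%:R).

(* The defining sum of [stirling2] starts at [m = 1]; adding the term [m = 0]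
   changes nothing for [k > 0] and makes the recurrence start at [k = 0]. *)
Definition stirling2_full k n : R :=
  (-1) ^+ n / n`!%:R *
  \sum_(0 <= m < n.+1) ('C(n, m)%:R * (-1) ^+ m * m%:R ^+ k).

Lemma stirling2_fullE k n : (0 < k)%N -> stirling2 R k n = stirling2_full k n.
Proof.
move=> k0; rewrite /stirling2_full big_nat_recl//= expr0n (gtn_eqF k0).
rewrite mulr0 add0r.
by rewrite /stirling2 big_add1.
Qed.

Lemma stirling2_full0 n : stirling2_full 0 n = (n == 0%N)%:R.
Proof.
rewrite /stirling2_full.
have -> : \sum_(0 <= m < n.+1) ('C(n, m)%:R * (-1) ^+ m * m%:R ^+ 0) =
    (1 + -1) ^+ n :> R.
  rewrite exprDn big_mkord; apply: eq_bigr => m _.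
  by rewrite expr1n mul1r expr0 mulr1 mulr_natl.
rewrite subrr expr0n; case: n => [|n]; last by rewrite mulr0.
by rewrite expr0 fact0 divr1 mulr1.
Qed.

Lemma stirling2_fullS0 k : stirling2_full k.+1 0 = 0.
Proof.
by rewrite /stirling2_full big_nat1 mulr0n expr0n !mulr0.
Qed.

(** Rests on [(n+1) C(n,m) = (n+1-m) C(n+1,m)], which rewrites the extra factor [m] in [m C(n+1,m)]
    as [(n+1) (C(n+1,m) - C(n,m))]. *)
Lemma stirling2_fullSS k n :
  stirling2_full k.+1 n.+1 =
  n.+1%:R * stirling2_full k n.+1 + stirling2_full k n.
Proof.
have E : \sum_(0 <= m < n.+2) ('C(n.+1, m)%:R * (-1) ^+ m * m%:R ^+ k.+1) =
    n.+1%:R * \sum_(0 <= m < n.+2) ('C(n.+1, m)%:R * (-1) ^+ m * m%:R ^+ k) -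
    n.+1%:R * \sum_(0 <= m < n.+1) ('C(n, m)%:R * (-1) ^+ m * m%:R ^+ k) :> R.
  rewrite [X in _ = _ - _ * X](_ : _ = \sum_(0 <= m < n.+2)
      ('C(n, m)%:R * (-1) ^+ m * m%:R ^+ k)); last first.
    by rewrite [RHS]big_nat_recr//= bin_small// !mul0r addr0.
  rewrite !mulr_sumr -sumrB; apply: eq_big_nat => m /andP[_ mn].
  have := congr1 (fun i => i%:R : R) (mul_bin_down n.+1 m).
  rewrite /= !natrM natrB// => H.
  rewrite exprSr.
  transitivity ((-1) ^+ m * m%:R ^+ k *
    (n.+1%:R * 'C(n.+1, m)%:R - (n.+1%:R - m%:R) * 'C(n.+1, m)%:R) : R).
    by ring.
  by rewrite -H; ring.
rewrite /stirling2_full E factS natrM exprS.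
have n0 : n`!%:R != 0 :> R by rewrite pnatr_eq0 -lt0n fact_gt0.
have n1 : n.+1%:R != 0 :> R by rewrite pnatr_eq0.
by field; rewrite n0 nat1r n1.
Qed.

Lemma stirling2_full_gt k n : (k < n)%N -> stirling2_full k n = 0.
Proof.
elim: k n => [|k IH] [|n]//; first by rewrite stirling2_full0.
by rewrite ltnS => kn; rewrite stirling2_fullSS !IH ?mulr0 ?addr0// ltnW.
Qed.

Lemma stirling2_diag k : (0 < k)%N -> stirling2 R k k = 1.
Proof.
move=> k0; rewrite stirling2_fullE// => {k0}.
elim: k => [|k IH]; first by rewrite stirling2_full0.
by rewrite stirling2_fullSS stirling2_full_gt// mulr0 add0r.
Qed.

(** Induction on [k] through [x * falling n x = falling n.+1 x + n * falling n x], matched with the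
    recurrence [stirling2_fullSS]. *)
Lemma expr_stirling2_full k x :
  x ^+ k = \sum_(0 <= n < k.+1) stirling2_full k n * falling n x.
Proof.
elim: k => [|k IH].
  by rewrite big_nat1 stirling2_full0 /falling big_geq// mulr1.
rewrite exprS IH mulr_sumr [RHS]big_nat_recl//= stirling2_fullS0 mul0r add0r.
under [RHS]eq_bigr do rewrite stirling2_fullSS mulrDl.
rewrite big_split /=.
(* Shifting the index is free: the new term at 0 carries the factor 0, and the lost top one contains
   [stirling2_full k k.+1 = 0]. *)
have -> : \sum_(0 <= n < k.+1)
      n.+1%:R * stirling2_full k n.+1 * falling n.+1 x =
    \sum_(0 <= n < k.+1) n%:R * stirling2_full k n * falling n x.
  transitivity (\sum_(0 <= n < k.+2) n%:R * stirling2_full k n * falling n x).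
    by rewrite [RHS]big_nat_recl//= !mul0r add0r.
  by rewrite big_nat_recr//= stirling2_full_gt// mulr0 mul0r addr0.
rewrite -big_split; apply: eq_bigr => n _ /=.
by rewrite [falling n.+1 x]big_nat_recr//= -/(falling n x); ring.
Qed.

Lemma rising_falling k x : rising k x = (-1) ^+ k * falling k (- x).
Proof.
elim: k => [|k IH]; first by rewrite /rising /falling !big_geq// mulr1.
rewrite [LHS]big_nat_recr//= -/(rising k x) IH.
by rewrite [falling k.+1 _]big_nat_recr//= -/(falling k (- x)) exprS; ring.
Qed.

(** The falling expansion evaluated at [- x]; the reflection [rising_falling] produces the signs
    that later become those of [(- alpha) ^ (j - k)]. *)
Lemma expr_rising k x : (0 < k)%N ->
  x ^+ k = \sum_(1 <= j < k.+1) (-1) ^+ (k + j) * stirling2 R k j * rising j x.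
Proof.
move=> k0.
have -> : x ^+ k = (-1) ^+ k * (- x) ^+ k.
  by rewrite -exprMn mulrN mulN1r opprK.
have S0 : stirling2_full k 0 = 0.
  by case: k k0 => // k _; exact: stirling2_fullS0.
rewrite (expr_stirling2_full k (- x)) big_nat_recl//= S0 mul0r add0r big_add1.
rewrite mulr_sumr; apply: eq_bigr => j _.
rewrite stirling2_fullE// rising_falling.
have : (-1) ^+ j.+1 * (-1) ^+ j.+1 = 1 :> R.
  by rewrite -exprMn mulrNN mulr1 expr1n.
rewrite exprD => H; rewrite -[LHS]mul1r -[X in X * _ = _]H; ring.
Qed.

Lemma falling_stirling1 k x :
  falling k x = \sum_(0 <= j < k.+1) stirling1 R k j * x ^+ j.
Proof.
set p : {poly R} := \prod_(0 <= i < k) ('X - i%:R%:P).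
have sp : size p = k.+1 by rewrite size_prod_XsubC size_iota subn0.
have -> : falling k x = p.[x].
  rewrite horner_prod; apply: eq_bigr => i _.
  by rewrite hornerXsubC.
by rewrite horner_coef sp big_mkord.
Qed.

Lemma stirling1_diag k : stirling1 R k k = 1.
Proof.
have := monic_prod_XsubC (index_iota 0 k) xpredT (fun i : nat => i%:R : R).
rewrite monicE lead_coefE size_prod_XsubC size_iota subn0 => /eqP <-.
by [].
Qed.

Lemma rising_stirling1 k x : (0 < k)%N ->
  rising k x = \sum_(1 <= j < k.+1) (-1) ^+ (k + j) * stirling1 R k j * x ^+ j.
Proof.
move=> k0; rewrite rising_falling falling_stirling1 big_nat_recl//=.
have -> : stirling1 R k 0 = 0.
  rewrite /stirling1 -horner_coef0 horner_prod; case: k k0 => // k _.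
  by rewrite big_nat_recl//= hornerXsubC subrr mul0r.
rewrite mul0r add0r big_add1 mulr_sumr; apply: eq_bigr => j _.
by rewrite [(- x) ^+ _]exprNn exprD; ring.
Qed.

Lemma rising_nat k n : rising k n.+1%:R = ('C(n + k, k) * k`!)%:R.
Proof.
rewrite bin_ffact; elim: k => [|k IH]; first by rewrite /rising big_geq.
rewrite [LHS]big_nat_recr//= -/(rising k n.+1%:R) IH -natrD -natrM.
by rewrite mulnC addSn addnS ffactSS.
Qed.

(** For order [k.+1] both terms share the factor [rising k n.+1], with cofactors [n + k + 1] and
    [n], whose difference is [k + 1]. *)
Lemma risingB k n : (0 < k)%N ->
  rising k n.+1%:R - rising k n%:R = (k`! * rising_coef k n)%:R.
Proof.
case: k => // k _; rewrite {1}/rising big_nat_recr//= -/(rising k n.+1%:R).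
have -> : rising k.+1 n%:R = n%:R * rising k n.+1%:R.
  rewrite [LHS]big_nat_recl//= addr0; congr (_ * _).
  by apply: eq_bigr => i _; rewrite -!natrD addnS addSn.
by rewrite rising_nat factS !natrM -!natr1; ring.
Qed.

End Stirling.

(** * Moments of the exit index through summation by parts *)

Lemma cvg_sum_nat (R : realType) (a b : nat)
    (F : nat -> nat -> R) (l : nat -> R) :
  (forall j, (a <= j)%N -> F j N @[N --> \oo] --> l j) ->
  \sum_(a <= j < b) F j N @[N --> \oo] --> \sum_(a <= j < b) l j.
Proof.
move=> Fl; rewrite big_nat; under eq_fun do rewrite big_nat.
apply: cvg_big => [|j /andP[aj _]]; [exact: add_continuous|exact: Fl].
Qed.

Section Moments.
Variables (R : realType) (I : choiceType) (s : seq I) (K : I -> I -> R).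
Hypothesis mem_s : forall x, x \in s.
Hypothesis K_ge0 : forall x y, 0 <= K x y.
Hypothesis K_le1 : forall x, \sum_(y <- s) K x y <= 1.
Hypothesis K_max : forall f : I -> R,
  (forall x, f x <= \sum_(y <- s) K x y * f y) -> forall x, f x <= 0.

(** Truncation at [N] of the expectation of [phi] at the exit index, for [phi 0 = 0], with [surv] as
    tail probabilities. *)
Definition diff_sum (phi : R -> R) (N : nat) (x : I) : R :=
  \sum_(0 <= n < N) (phi n.+1%:R - phi n%:R) * surv s K n x.

(** Stands for the [k]-th moment of the exit index, written in the rising basis where convergence is
    known; [diff_sum_power_cvg] justifies it. *)
Definition power_moment (k : nat) (x : I) : R :=
  \sum_(1 <= j < k.+1) (-1) ^+ (k + j) * stirling2 R k j *
    (j`!%:R * rising_moment s K j x).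

Lemma diff_sum_comb (a b : nat) (c : nat -> R) (phi : nat -> R -> R) N x :
  diff_sum (fun t => \sum_(a <= j < b) c j * phi j t) N x =
  \sum_(a <= j < b) c j * diff_sum (phi j) N x.
Proof.
under [RHS]eq_bigr do rewrite mulr_sumr.
rewrite exchange_big; apply: eq_bigr => n _.
rewrite -sumrB mulr_suml; apply: eq_bigr => j _ /=; ring.
Qed.

Lemma diff_sum_rising (k N : nat) (x : I) : (0 < k)%N ->
  diff_sum (rising k) N x = k`!%:R * rising_sum s K k N x.
Proof.
move=> k0; rewrite mulr_sumr; apply: eq_bigr => n _.
by rewrite risingB// natrM mulrA.
Qed.

Lemma diff_sum_rising_cvg (k : nat) (x : I) : (0 < k)%N ->
  diff_sum (rising k) N x @[N --> \oo] --> k`!%:R * rising_moment s K k x.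
Proof.
move=> k0; under eq_fun do rewrite diff_sum_rising//.
by apply: cvgMl_tmp; exact: rising_sum_cvg.
Qed.

Lemma diff_sum_power_cvg (k : nat) (x : I) : (0 < k)%N ->
  diff_sum (fun t => t ^+ k) N x @[N --> \oo] --> power_moment k x.
Proof.
move=> k0; rewrite (_ : (fun t => t ^+ k) = (fun t => \sum_(1 <= j < k.+1)
    (-1) ^+ (k + j) * stirling2 R k j * rising j t)); last first.
  by apply/funext => t; exact: expr_rising.
under eq_fun do rewrite diff_sum_comb.
apply: cvg_sum_nat => j j0.
by apply: cvgMl_tmp; exact: diff_sum_rising_cvg.
Qed.

(** Both sides are limits of the same [diff_sum (rising k)], so uniqueness of limits replaces the
    orthogonality of the two kinds of Stirling numbers. *)
Lemma rising_power_moment (k : nat) (x : I) : (0 < k)%N ->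
  k`!%:R * rising_moment s K k x =
  \sum_(1 <= j < k.+1) (-1) ^+ (k + j) * stirling1 R k j * power_moment j x.
Proof.
move=> k0; rewrite -(cvg_lim _ (diff_sum_rising_cvg (x := x) k0))//.
apply/cvg_lim => //.
rewrite (_ : rising k = (fun t => \sum_(1 <= j < k.+1)
    (-1) ^+ (k + j) * stirling1 R k j * t ^+ j)); last first.
  by apply/funext => t; exact: rising_stirling1.
under eq_fun do rewrite (diff_sum_comb _ _ _ (fun j t => t ^+ j)).
apply: cvg_sum_nat => j j0.
by apply: cvgMl_tmp; exact: diff_sum_power_cvg.
Qed.

End Moments.

(** * Probability that the Markov chain stays in a finite set *)

Section Chain.
Variables (R : realType) (V : choiceType) (p : V -> V -> R).
Variables (d : measure_display) (Omega : measurableType d).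
Variables (P : V -> probability Omega R) (X : nat -> Omega -> V).
Hypothesis mc : is_markov_chain p P X.
Variables (A : set V) (s : seq A).
Hypothesis s_uniq : uniq s.
Hypothesis mem_s : forall x, x \in s.

Local Notation K := (fun x y : A => p (val x) (val y)).

Definition cylinder (n : nat) (t : nat -> V) : set Omega :=
  [set w | forall i, (i <= n)%N -> X i w = t i].

Definition stays (n m : nat) : set Omega :=
  [set w | forall i, (n < i <= n + m)%N -> A (X i w)].

Lemma measurable_preX (n : nat) (B : set V) : measurable (X n @^-1` B).
Proof. by case: mc. Qed.

Lemma measurable_cylinder (n : nat) (t : nat -> V) : measurable (cylinder n t).
Proof.
rewrite (_ : cylinder n t =
  \bigcap_(i in [set i | (i <= n)%N]) X i @^-1` [set t i]) //.
by apply: bigcap_measurable; [exists 0%N|move=> i _; exact: measurable_preX].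
Qed.

Lemma measurable_stays (n m : nat) : measurable (stays n m).
Proof.
rewrite (_ : stays n m =
  \bigcap_(i in [set i | (n < i <= n + m)%N]) X i @^-1` A) //.
by apply: bigcap_measurableType => i _; exact: measurable_preX.
Qed.

(** Induction on [m], splitting over the position [z] in [A] at time [n + 1]: the Markov property of
    the longer cylinder supplies the factor [p y z], and summing over [z] applies the kernel once
    more. *)
Lemma cylinder_stays (x : V) (m n : nat) (t : nat -> V) (y : A) :
  t n = val y ->
  P x (cylinder n t `&` stays n m) =
  (P x (cylinder n t) * (surv s K m y)%:E)%E.
Proof.
elim: m n t y => [|m IH] n t y tn.
  rewrite mule1; congr (P x _); apply/setIidPl => w _ i.
  by rewrite addn0 ltnNge => /andP[/negbTE->].
(* The prescribed path [t] extended by a step to [z]. *)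
pose tz (z : A) i := if i == n.+1 then val z else t i.
have tzE (z : A) w : cylinder n.+1 (tz z) w <->
    cylinder n t w /\ X n.+1 w = val z.
  split=> [H|[H E] i].
    split=> [i i_n|]; last by rewrite H// /tz eqxx.
    by rewrite H ?(leq_trans i_n)// /tz ltn_eqF.
  rewrite leq_eqVlt /tz; case: eqVneq => [-> //|_ /=]; exact: H.
have -> : cylinder n t `&` stays n m.+1 =
    \bigcup_(z in [set` s]) (cylinder n.+1 (tz z) `&` stays n.+1 m).
  apply/seteqP; split=> w.
    move=> [Hc Hs]; have An : A (X n.+1 w).
      by apply: Hs; rewrite ltnS leqnn addnS ltnS leq_addr.
    exists (SigSub (mem_set An)); first exact: mem_s.
    split; first by apply/tzE.
    by move=> i /andP[ni im]; apply: Hs; rewrite (ltn_trans _ ni)//= -addSnnS.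
  move=> [z _ [/tzE[Hc E] Hs]]; split=> // i /andP[].
  rewrite leq_eqVlt => /predU1P[<- _|ni im].
    by rewrite E; exact: set_valP.
  by apply: Hs; rewrite ni addSnnS.
rewrite measure_fin_bigcup//; last 3 first.
- exact: finite_seq.
- move=> z1 z2 _ _ [w [[/tzE[_ E1] _] [/tzE[_ E2] _]]].
  by apply: val_inj; rewrite -E1.
- move=> z _; apply: measurableI; first exact: measurable_cylinder.
  exact: measurable_stays.
rewrite -fsbig_seq//.
have Pfin : (P x (cylinder n t)) \is a fin_num.
  by apply: fin_num_measure; exact: measurable_cylinder.
rewrite -(fineK Pfin) -EFinM mulr_sumr -sumEFin; apply: eq_bigr => z _.
apply: (etrans (IH n.+1 (tz z) z _)); first by rewrite /tz eqxx.
case: mc => _ _ /(_ x n (tz z)).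
rewrite -/(cylinder n.+1 (tz z)) => ->.
have -> : [set w | forall i, (i <= n)%N -> X i w = tz z i] = cylinder n t.
  apply/seteqP; split=> w H i i_n; have := H i i_n; by rewrite /tz ltn_eqF.
by rewrite -(fineK Pfin) /tz eqxx ltn_eqF// tn -!EFinM mulrA.
Qed.

Lemma stay_probability (x : A) (n : nat) :
  P (val x) [set w | forall i, (i <= n)%N -> A (X i w)] = (surv s K n x)%:E.
Proof.
have PX0 : P (val x) [set w | X 0%N w = val x] = 1%E by case: mc.
have mX0 : measurable [set w | X 0%N w = val x].
  exact: (measurable_preX 0 [set val x]).
set E := [set w | _].
have mE : measurable E.
  rewrite (_ : E = \bigcap_(i in [set i | (i <= n)%N]) X i @^-1` A) //.
  by apply: bigcap_measurableType => i _; exact: measurable_preX.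
(* The start at [x] is only almost sure, so the event is first cut down by a null set. *)
have -> : P (val x) E = P (val x) (E `&` [set w | X 0%N w = val x]).
  rewrite (measureDI _ mE mX0) [X in (X + _)%E](_ : _ = 0%E) ?add0e//.
  apply/eqP; rewrite eq_le measure_ge0 andbT.
  apply: (@le_trans _ _ (P (val x) (~` [set w | X 0%N w = val x]))).
    by apply: le_measure => [||w []//]; apply/mem_set;
      [exact: measurableD|exact: measurableC].
  by rewrite probability_setC// PX0 subee.
have := @cylinder_stays (val x) n 0 (fun=> val x) x erefl.
rewrite (_ : cylinder 0 _ = [set w | X 0%N w = val x]); last first.
  by apply/seteqP; split=> w /= H; [exact: H|move=> i; rewrite leqn0 => /eqP->].
rewrite PX0 mul1e => <-; congr (P _ _); apply/seteqP; split=> w /=.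
  by move=> [H ->]; split=> // i /andP[_ i_n]; exact: H.
move=> [w0 H]; split=> // -[_|i i_n]; first by rewrite w0; exact: set_valP.
exact: H.
Qed.

End Chain.

(** * Powers of the exit time as series, and their expectations *)

(** The partial sums telescope to [c * N ^ k], which is at least [c * N]. *)
Lemma eseries_power_pinfty (R : realType) (c : R) (k : nat) :
  0 < c -> (0 < k)%N ->
  (\sum_(0 <= n <oo) (c * (n.+1%:R ^+ k - n%:R ^+ k))%:E = +oo)%E.
Proof.
move=> c0 k0.
set S := (\sum_(0 <= n <oo) _)%E.
have le_pow n : n%:R ^+ k <= n.+1%:R ^+ k :> R.
  by rewrite lerXn2r ?nnegrE ?ler0n// ler_nat.
have SN N : ((c * N%:R)%:E <= S)%E.
  apply: (@le_trans _ _ (c * N%:R ^+ k)%:E).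
    rewrite lee_fin ler_pM2l// -natrX ler_nat.
    by case: N => // N; rewrite -{1}(expn1 N.+1) leq_pexp2l.
  have -> : (c * N%:R ^+ k)%:E =
      (\sum_(0 <= n < N) (c * (n.+1%:R ^+ k - n%:R ^+ k))%:E)%E.
    rewrite sumEFin -mulr_sumr telescope_sumr// expr0n.
    by rewrite (gtn_eqF k0) subr0.
  apply: nneseries_lim_ge => n _ _.
  by rewrite lee_fin mulr_ge0 ?subr_ge0// ltW.
case: S SN => [r| |] SN //; last by have := SN 0%N.
have := SN (Num.bound (r / c)); rewrite lee_fin -ler_pdivlMl// leNgt.
rewrite mulrC archi_boundP//.
have := SN 0%N; rewrite lee_fin mulr0 => r0; exact: divr_ge0 (ltW c0).
Qed.

Lemma eseries_power_initial (R : realType) (c : R) (k m : nat) :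
  (0 < k)%N ->
  (\sum_(0 <= n <oo | (n < m)%N) (c * (n.+1%:R ^+ k - n%:R ^+ k))%:E =
   (c * m%:R ^+ k)%:E)%E.
Proof.
move=> k0; apply/lim_near_cst => //.
exists m => // N /= mN.
rewrite -[LHS](big_nat_widen 0 m N xpredT _ mN) sumEFin -mulr_sumr.
by rewrite telescope_sumr// expr0n (gtn_eqF k0) subr0.
Qed.

Section ExitTime.
Variables (R : realType) (V : choiceType) (G : bigraph V) (W : weighting R G).
Variables (D : subgraph G) (d : measure_display) (Omega : measurableType d).
Variables (P : V -> probability Omega R) (X : nat -> Omega -> V).
Hypothesis mc : is_markov_chain (walk_prob W) P X.
Variable alpha : R.
Hypothesis alpha_gt0 : 0 < alpha.
Hypothesis regular : weight_regular W alpha D.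

Definition inside (n : nat) : set Omega :=
  [set w | forall i, (i <= n)%N -> sub_interior D (X i w)].

(** A set of integers all above [n] has infimum at least [n.+1]; this also covers the empty set,
    where the index is [+oo]. *)
Lemma lt_exit_index (n : nat) (w : Omega) :
  (n%:R%:E < exit_index R D X w :> \bar R)%E <-> inside n w.
Proof.
split=> [nw i i_n|H].
  apply: contrapT => Xi; move: nw; apply/negP; rewrite -leNgt.
  apply: (@le_trans _ _ i%:R%:E); last by rewrite lee_fin ler_nat.
  by apply: ereal_inf_lbound; exists i.
apply: (@lt_le_trans _ _ n.+1%:R%:E); first by rewrite lte_fin ltr_nat.
apply: le_ereal_inf_tmp => _ [i Xi <-]; rewrite lee_fin ler_nat ltnNge.
by apply/negP => i_n; exact: Xi (H _ i_n).
Qed.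

(** The factor [n.+1 ^+ 1 - n ^+ 1] is 1; it puts the series in the shape of [exit_time_expr], so
    that the same two series lemmas evaluate both. *)
Lemma exit_time_series (w : Omega) :
  exit_time W D X w = (\sum_(0 <= n <oo | w \in inside n)
    (alpha^-1 * (n.+1%:R ^+ 1 - n%:R ^+ 1))%:E)%E.
Proof.
rewrite /exit_time (@eq_eseriesl _ _ (fun n => w \in inside n)); last first.
  by move=> n; apply/idP/idP => [/lt_exit_index/mem_set|/set_mem/lt_exit_index].
apply: eq_eseriesr => n /set_mem H.
by rewrite regular; [rewrite !expr1 -natr1 addrAC subrr add0r mulr1|exact: H].
Qed.

(** Holds for every [w]: both sides are [+oo] if the walk never exits, and otherwise both telescope
    to the [k]-th power of [m' / alpha], with [m'] the first time outside. *)
Lemma exit_time_expr (k : nat) (w : Omega) : (0 < k)%N ->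
  (exit_time W D X w ^+ k)%E =
  (\sum_(0 <= n <oo | w \in inside n)
    (alpha ^- k * (n.+1%:R ^+ k - n%:R ^+ k))%:E)%E.
Proof.
move=> k0; rewrite exit_time_series.
have [[m wm]|H] := pselect (exists m, ~ inside m w); last first.
  have wn n : w \in inside n.
    by apply/mem_set; apply: contrapT => Hn; apply: H; exists n.
  rewrite !(@eq_eseriesl _ (fun n => w \in inside n) xpredT)//.
  rewrite !eseries_power_pinfty ?invr_gt0 ?exprn_gt0//.
  by case: k k0 => // k _; elim: k => // k IH; rewrite expeS IH mulyy.
have [m' m'P mmin] := ex_minnP (P := fun m => w \notin inside m)
  (ex_intro _ m (negbT (memNset wm))).
have E n : (w \in inside n) = (n < m')%N.
  apply/idP/idP => [/set_mem wn|nm].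
    rewrite ltnNge; apply/negP => mn; move/negP: m'P; apply.
    apply/mem_set => i im.
    exact: wn (leq_trans im mn).
  by apply/negP => /negP/mmin; rewrite leqNgt nm.
rewrite !(@eq_eseriesl _ (fun n => w \in inside n) (fun n => (n < m')%N))//.
by rewrite !eseries_power_initial// expr1 -EFin_expe exprMn exprVn.
Qed.

Lemma measurable_inside (n : nat) : measurable (inside n).
Proof.
rewrite (_ : inside n =
  \bigcap_(i in [set i | (i <= n)%N]) X i @^-1` sub_interior D) //.
by apply: bigcap_measurableType => i _; case: mc.
Qed.

Variable s : seq (sub_interior D).
Hypothesis s_uniq : uniq s.
Hypothesis mem_s : forall x, x \in s.

Local Notation K := (fun x y : sub_interior D => walk_prob W (val x) (val y)).
Hypothesis K_ge0 : forall x y, 0 <= K x y.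
Hypothesis K_le1 : forall x, \sum_(y <- s) K x y <= 1.
Hypothesis K_max : forall f : sub_interior D -> R,
  (forall x, f x <= \sum_(y <- s) K x y * f y) -> forall x, f x <= 0.

(** The terms of the series are nonnegative, so it is integrated termwise; each indicator
    contributes a survival probability. *)
Lemma exit_time_moment (k : nat) (x : sub_interior D) : (0 < k)%N ->
  (\int[P (val x)]_w (exit_time W D X w ^+ k))%E =
  (alpha ^- k * power_moment s K k x)%:E.
Proof.
move=> k0.
pose c n : R := alpha ^- k * (n.+1%:R ^+ k - n%:R ^+ k).
have c0 n : 0 <= c n.
  rewrite mulr_ge0 ?invr_ge0 ?exprn_ge0 ?(ltW alpha_gt0)// subr_ge0.
  by rewrite lerXn2r ?nnegrE ?ler0n// ler_nat.
under eq_integral => w _ do rewrite exit_time_expr// eseries_mkcond.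
transitivity (\int[P (val x)]_w
    (\sum_(0 <= n <oo) ((c n)%:E * (\1_(inside n) w)%:E)))%E.
  apply: eq_integral => w _; apply: eq_eseriesr => n _.
  by rewrite indicE; case: ifP => _; rewrite (mule1, mule0).
rewrite integral_nneseries//; last 2 first.
- move=> n; apply: measurable_funeM; apply/measurable_EFinP.
  by apply: measurable_indic; exact: measurable_inside.
- by move=> n w _; rewrite mule_ge0// lee_fin.
transitivity (\sum_(0 <= n <oo) (c n * surv s K n x)%:E)%E.
  apply: eq_eseriesr => n _.
  have mI : measurable_fun setT (fun w => (\1_(inside n) w)%:E : \bar R).
    apply/measurable_EFinP.
    by apply: measurable_indic; exact: measurable_inside.
  rewrite ge0_integralZl_EFin//.
  rewrite integral_indic//; last exact: measurable_inside.
  rewrite setIT [RHS]EFinM; congr (_ * _)%E.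
  exact: (stay_probability mc s_uniq mem_s).
apply/cvg_lim => //.
under eq_fun do rewrite sumEFin.
apply: cvg_EFin; first by near=> n.
under eq_fun => N /=.
  under eq_bigr do rewrite -mulrA.
  rewrite -mulr_sumr -/(diff_sum s K (fun t => t ^+ k) N x); over.
by apply: cvgMl_tmp; exact: diff_sum_power_cvg.
Unshelve. all: by end_near. Qed.

End ExitTime.

(** * The walk killed outside the interior of a domain, and the values of [A1] and [A2] *)

Lemma exists_argmax (R : realType) (I : eqType) (f : I -> R) (s : seq I)
    (x0 : I) :
  x0 \in s -> exists2 x, x \in s & forall y, y \in s -> f y <= f x.
Proof.
elim: s x0 => // a s IH x0 _.
case: s IH => [|b s] IH.
  by exists a => [|y]; rewrite inE// => /eqP->.
have [x xs xmax] := IH b (mem_head _ _).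
have [ax|xa] := leP (f a) (f x).
  exists x => [|y]; first by rewrite inE xs orbT.
  by rewrite inE => /predU1P[->//|]; exact: xmax.
exists a => [|y]; first exact: mem_head.
rewrite inE => /predU1P[->//|ys].
exact: le_trans (xmax _ ys) (ltW xa).
Qed.

Section Domain.
Variables (R : realType) (V : choiceType) (GW : geometric_graph R V).
Variables (D : subgraph (graph GW)) (alpha : R).
Hypothesis D_domain : is_domain D.
Hypothesis regular : weight_regular (weights GW) alpha D.
Hypothesis D_boundary : sub_boundary D !=set0.

Local Notation W := (weights GW).
Local Notation iD := (sub_interior D).

Definition interior_walk (x y : iD) : R := walk_prob W (val x) (val y).
Local Notation K := interior_walk.

Lemma finite_interior : finite_set iD.
Proof.
by case: D_domain => finD _ _; apply: sub_finite_set finD => x [].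
Qed.

Lemma finite_interiorT : finite_set [set: iD].
Proof. by rewrite (eq_finite_set (card_setT _)); exact: finite_interior. Qed.

Definition interior_seq : seq iD := enum_fset (fset_set [set: iD]).

Definition neighbors (x : V) : seq V :=
  enum_fset (fset_set [set y | edge (graph GW) x y]).

Lemma interior_seq_uniq : uniq interior_seq.
Proof. exact: fset_uniq. Qed.

Lemma mem_interior_seq (x : iD) : x \in interior_seq.
Proof. by rewrite in_fset_set ?in_setT//; exact: finite_interiorT. Qed.

Lemma mem_neighbors (x y : V) : (y \in neighbors x) = edge (graph GW) x y.
Proof. by rewrite in_fset_set ?mem_setE//; exact: edge_finite. Qed.

Lemma aux_weightE (x : V) : aux_weight W x = \sum_(y <- neighbors x) WE W x y.
Proof. by rewrite /aux_weight fsbig_finite//; exact: edge_finite. Qed.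

Lemma fsum_interior (F : iD -> R) :
  \sum_(x \in [set: iD]) F x = \sum_(x <- interior_seq) F x.
Proof. by rewrite fsbig_finite//; exact: finite_interiorT. Qed.

Lemma WE_eq0 (x y : V) : ~~ edge (graph GW) x y -> WE W x y = 0.
Proof.
by rewrite -(WE_gt0 W) -leNgt => H; apply/eqP; rewrite eq_le H WE_ge0.
Qed.

(** [WE] vanishes off edges and [g] off the interior, so both sums reduce to the interior neighbours
    of [x]. *)
Lemma sum_interior_neighbors (x : V) (g : V -> R) :
  (forall z, z \notin iD -> g z = 0) ->
  \sum_(y <- interior_seq) WE W x (val y) * g (val y) =
  \sum_(z <- neighbors x) WE W x z * g z.
Proof.
move=> g0; rewrite -(big_map val xpredT (fun z => WE W x z * g z)).
rewrite (bigID (fun z => edge (graph GW) x z)) /= [X in _ + X]big1 ?addr0;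
  last first.
  by move=> z /WE_eq0->; rewrite mul0r.
rewrite [RHS](bigID (fun z => z \in iD)) /= [X in _ = _ + X]big1 ?addr0;
  last first.
  by move=> z /g0->; rewrite mulr0.
rewrite -big_filter -[RHS]big_filter; apply: perm_big; apply: uniq_perm.
- by rewrite filter_uniq// map_inj_uniq ?interior_seq_uniq//; exact: val_inj.
- by rewrite filter_uniq//; exact: fset_uniq.
move=> z; rewrite !mem_filter mem_neighbors andbC; congr (_ && _).
apply/mapP/idP => [[y _ ->]|zD]; first exact: valP.
by exists (SigSub zD) => //; exact: mem_interior_seq.
Qed.

Lemma interior_exit_path (x : iD) :
  exists b p,
    [/\ path (edge (graph GW)) (val x) p, last (val x) p = b & ~ iD b].
Proof.
have [b [_ Db]] := D_boundary.
have [//|//|p px lb] := @graph_connected _ _ GW (val x) b.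
by exists b, p.
Qed.

(** A path from an interior vertex to a boundary vertex is nonempty, so its first edge gives
    positive weight. *)
Lemma alpha_gt0 : 0 < alpha.
Proof.
have [_ _ [x Dx]] := D_domain.
have [b [p [px lb Db]]] := interior_exit_path (SigSub (mem_set Dx)).
case: p px lb => [_ /= xb|y p /= /andP[xy _] _]; first by rewrite -xb in Db.
rewrite -(regular Dx) aux_weightE (big_rem y) ?mem_neighbors//=.
by rewrite ltr_wpDr ?WE_gt0// sumr_ge0// => z _; exact: WE_ge0.
Qed.

Lemma interior_walkE (x y : iD) : K x y = alpha^-1 * WE W (val x) (val y).
Proof.
by rewrite /interior_walk /walk_prob regular 1?mulrC//; exact: set_valP.
Qed.

Lemma interior_walk_ge0 (x y : iD) : 0 <= K x y.
Proof.
by rewrite interior_walkE mulr_ge0 ?WE_ge0// invr_ge0 ltW// alpha_gt0.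
Qed.

Lemma interior_walk_le1 (x : iD) : \sum_(y <- interior_seq) K x y <= 1.
Proof.
rewrite (eq_bigr _ (fun y _ => interior_walkE x y)).
rewrite -mulr_sumr ler_pdivrMl ?alpha_gt0// mulr1.
(* The indicator of the interior: dropping it restores the weights of the edges that leave [iD]. *)
pose g z : R := (z \in iD)%:R.
have -> : \sum_(y <- interior_seq) WE W (val x) (val y) =
    \sum_(y <- interior_seq) WE W (val x) (val y) * g (val y).
  by apply: eq_bigr => y _; rewrite /g (valP y) mulr1.
rewrite sum_interior_neighbors; last by move=> z /negbTE zD; rewrite /g zD.
rewrite -(regular (set_valP x)) aux_weightE; apply: ler_sum => z _.
by rewrite ler_piMr ?WE_ge0// /g; case: (_ \in _).
Qed.

(* At a positive maximum of a subharmonic [f], the weights going out of the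
   point sum to [alpha], so all the neighbours are interior maxima as well; by
   connectedness a maximum would then be attained on the boundary. *)
Lemma interior_walk_max (f : iD -> R) :
  (forall x, f x <= \sum_(y <- interior_seq) K x y * f y) ->
  forall x, f x <= 0.
Proof.
move=> fK x0; rewrite leNgt; apply/negP => fx0.
have [x1 _ x1max] := exists_argmax f (mem_interior_seq x0).
have M0 : 0 < f x1 by apply: (lt_le_trans fx0); exact/x1max/mem_interior_seq.
(* Extension of [f] by 0 to all vertices; it stays below the positive maximum. *)
pose g z := oapp f 0 (insub z : option iD).
have gD y : g (val y) = f y by rewrite /g valK.
have gN z : z \notin iD -> g z = 0 by move=> zD; rewrite /g insubN.
have gM z : g z <= f x1.
  rewrite /g; case: insubP => [y _ _|_] /=; last exact: ltW.
  exact/x1max/mem_interior_seq.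
have step (x : iD) z : f x = f x1 -> edge (graph GW) (val x) z ->
    exists2 y : iD, val y = z & f y = f x1.
  move=> fx xz.
  have : \sum_(z <- neighbors (val x)) WE W (val x) z * (f x1 - g z) <= 0.
    under eq_bigr do rewrite mulrBr.
    rewrite sumrB -mulr_suml -aux_weightE (regular (set_valP x)) subr_le0.
    rewrite -sum_interior_neighbors// -ler_pdivlMl ?alpha_gt0// -fx.
    apply: (le_trans (fK x)); rewrite mulr_sumr le_eqVlt; apply/orP; left.
    by apply/eqP/eq_bigr => y _; rewrite interior_walkE gD mulrA.
  rewrite (big_rem z) ?mem_neighbors//= => H.
  have {H} : WE W (val x) z * (f x1 - g z) <= 0.
    apply: le_trans H; rewrite lerDl; apply: sumr_ge0 => u _.
    by rewrite mulr_ge0 ?WE_ge0// subr_ge0.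
  rewrite pmulr_rle0 ?WE_gt0// subr_le0 => Mg.
  have {Mg} : g z = f x1 by apply/eqP; rewrite eq_le Mg gM.
  (* Outside the interior [g] is 0, which cannot equal the positive maximum. *)
  rewrite /g; case: insubP => [y _ yz fy|_ /= E]; first by exists y.
  by rewrite -E ltxx in M0.
have [b [p [px lb Db]]] := interior_exit_path x1.
have walk (x : iD) : f x = f x1 -> path (edge (graph GW)) (val x) p ->
    iD (last (val x) p).
  elim: p x {px lb} => [|z p IH] x fx /=; first by move=> _; exact: set_valP.
  by move=> /andP[/(step _ _ fx)[y <- fy]]; exact: IH.
by apply: Db; rewrite -lb; exact: walk.
Qed.

Lemma interior_walk_balance (x y : iD) :
  K x y * WV W (val x) = K y x * WV W (val y).
Proof. by rewrite !interior_walkE -!mulrA WE_balance. Qed.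

Local Notation m := (fun x : iD => WV W (val x)).
Local Notation s := interior_seq.

Lemma innerE (f g : C0 R D) : inner W f g = ip s m f g.
Proof. exact: fsum_interior. Qed.

Lemma interior_laplaceE : @interior_laplace R V _ W D = lap s K alpha.
Proof.
apply/funext => f; apply/funext => x.
rewrite /interior_laplace fsum_interior (regular (set_valP x)) /lap mulrBr.
rewrite /kop mulr_sumr; congr (_ - _); apply: eq_bigr => y _.
by rewrite interior_walkE !mulrA divff ?mul1r// gt_eqF// alpha_gt0.
Qed.

Lemma A2E (k : nat) :
  A2 W D k = (alpha ^- k * (k`!%:R * ip s m (rising_moment s K k) (cst 1)))%:E.
Proof.
have [_ _ [x0 Dx0]] := D_domain.
rewrite /A2 [X in ereal_sup X](_ : _ = [set (ip s m f (cst 1) ^+ 2 /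
    `|ip s m f (iter k (lap s K alpha) f)|)%:E
      | f in [set f : iD -> R | f <> cst 0]]).
  rewrite (sup_dual_quotient mem_interior_seq interior_walk_ge0
    interior_walk_le1 _
    interior_walk_balance alpha_gt0 interior_walk_max k (SigSub (mem_set Dx0))).
    by rewrite -EFinM mulrCA.
  by move=> x; exact/ltW/WV_gt0.
by apply: eq_imagel => f _; rewrite /dual_quotient !innerE interior_laplaceE.
Qed.

Variables (d : measure_display) (Omega : measurableType d).
Variables (P : V -> probability Omega R) (X : nat -> Omega -> V).
Hypothesis mc : is_markov_chain (walk_prob W) P X.

Lemma A1E (k : nat) : (0 < k)%N ->
  A1 W D P X k = (alpha ^- k * ip s m (power_moment s K k) (cst 1))%:E.
Proof.
move=> k0; rewrite /A1 (reindex_fsbig (fun x : iD => val x) [set: iD]);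
  last first.
  split=> [x _|x y _ _|x Dx]; [exact: set_valP|exact: val_inj|].
  by exists (SigSub (mem_set Dx)).
rewrite fsbig_finite; last exact: finite_interiorT.
rewrite mulr_sumr -sumEFin; apply: eq_bigr => x _.
rewrite (exit_time_moment mc alpha_gt0 regular interior_seq_uniq
  mem_interior_seq interior_walk_ge0 interior_walk_le1 interior_walk_max)//.
by rewrite -EFinM mulr1 mulrA.
Qed.

Lemma ip_suml (f : iD -> R) (a b : nat) (c : nat -> R) (F : nat -> iD -> R) :
  ip s m (fun x => \sum_(a <= j < b) c j * F j x) f =
  \sum_(a <= j < b) c j * ip s m (F j) f.
Proof.
under [RHS]eq_bigr do rewrite mulr_sumr.
rewrite exchange_big; apply: eq_bigr => x _ /=.
by rewrite !mulr_suml; apply: eq_bigr => j _; rewrite !mulrA.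
Qed.

End Domain.

(** * Powers of [alpha] and conclusion *)

(** Uses [(-1)^(k+j) alpha^-k = (-alpha)^(j-k) alpha^-j], with the diagonal coefficient 1 isolating
    the top term; it serves both identities with [x] and [y] exchanged. *)
Lemma rescale_stirling (R : realType) (alpha : R) (c x y : nat -> R) (k : nat) :
  alpha != 0 -> (0 < k)%N -> c k = 1 ->
  x k = \sum_(1 <= j < k.+1) (-1) ^+ (k + j) * c j * y j ->
  alpha ^- k * x k = alpha ^- k * y k +
    \sum_(1 <= j < k) ((- alpha) ^ (j%:Z - k%:Z) * c j) * (alpha ^- j * y j).
Proof.
move=> a0 k0 ck ->; rewrite big_nat_recr//= ck mulrDr addrC; congr (_ + _).
  by rewrite -signr_odd oddD addbb expr0 !mul1r.
rewrite mulr_sumr; apply: eq_bigr => j _.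
have aX n : alpha ^+ n != 0 by rewrite expf_neq0.
rewrite expfzDr ?oppr_eq0// -exprnP -exprnN !(exprNn alpha) invfM invr_sign.
rewrite exprD.
by field; rewrite !aX.
Qed.

Theorem theorem1p1 (R : realType) (V : choiceType) (GW : geometric_graph R V)
    (d : measure_display) (Omega : measurableType d)
    (P : V -> probability Omega R) (X : nat -> Omega -> V)
    (D : subgraph (graph GW)) (alpha : R) :
  is_markov_chain (walk_prob (weights GW)) P X ->
  is_domain D ->
  weight_regular (weights GW) alpha D ->
  sub_boundary D !=set0 ->
  forall k : nat, (0 < k)%N ->
    (A1 (weights GW) D P X k =
       A2 (weights GW) D k +
       \sum_(1 <= j < k)
         ((- alpha) ^ (j%:Z - k%:Z) * stirling2 R k j)%:E *
         A2 (weights GW) D j)%E /\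
    (A2 (weights GW) D k =
       A1 (weights GW) D P X k +
       \sum_(1 <= j < k)
         ((- alpha) ^ (j%:Z - k%:Z) * stirling1 R k j)%:E *
         A1 (weights GW) D P X j)%E.
Proof.
move=> mc D_domain regular D_boundary k k0.
have alpha0 : alpha != 0.
  by rewrite gt_eqF// (alpha_gt0 D_domain regular D_boundary).
have A1j := A1E D_domain regular D_boundary mc.
have A2j := A2E D_domain regular D_boundary.
rewrite big_nat [in X in _ /\ X]big_nat.
under eq_bigr => j _ do rewrite A2j -EFinM.
under [in X in _ /\ X]eq_bigr => j /andP[j0 _] do rewrite (A1j j j0) -EFinM.
rewrite !sumEFin -!big_nat (A1j k k0) A2j -!EFinD.
pose s := @interior_seq _ _ _ D; pose K := @interior_walk _ _ _ D.
pose inner1 f := ip s (fun x => WV (weights GW) (val x)) f (cst 1).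
(* [alpha ^- j * M j] is [A1] of order [j] for positive [j], and [alpha ^- j * N j] is [A2] of order
   [j]. *)
pose M j := inner1 (power_moment s K j).
pose N j := j`!%:R * inner1 (rising_moment s K j).
split; congr (_%:E).
- apply: (rescale_stirling (x := M) (y := N)) => //.
    exact: stirling2_diag.
  rewrite /M [LHS]ip_suml; apply: eq_bigr => j _; congr (_ * _).
  rewrite /N /inner1 /ip mulr_sumr; apply: eq_bigr => x _; ring.
- apply: (rescale_stirling (x := N) (y := M)) => //.
    exact: stirling1_diag.
  rewrite -[RHS]ip_suml /N /inner1 /ip mulr_sumr; apply: eq_bigr => x _.
  rewrite -rising_power_moment//; first by ring.
  + exact: mem_interior_seq.
  + exact: interior_walk_ge0 D_domain regular D_boundary.
  + exact: interior_walk_le1 D_domain regular D_boundary.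
  + exact: interior_walk_max D_domain regular D_boundary.
Qed.
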